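(* Let $\mathcal W\subset\mathbb R^d$ be a closed and bounded set in which the covariate $W$ takes values, let $\beta\in\mathbb R^d$, and let $B$ be an integrable real random variable (the contamination). Let $X_a(w)=w^\top\beta+\mathbb E[B]$ be the algorithmic prediction in the limit of infinitely many samples, let $X_h^l\le X_h^u$ be real numbers (human bounds), let $\hat X(w)=\max\{\min\{X_a(w),X_h^u\},X_h^l\}$, and let $l(x,w)=(x-w^\top\beta)^2$. If $$X_h^u\ \ge\ \max_{w\in\mathcal W}\{w^\top\beta\}-\big|\mathbb E[B]\big|,\qquad X_h^l\ \le\ \min_{w\in\mathcal W}\{w^\top\beta\}+\big|\mathbb E[B]\big|,$$ then $l(\hat X(w),w)\le l(X_a(w),w)$ for all $w\in\mathcal W$, and $\mathbb E[l(\hat X(W),W)]\le\mathbb E[l(X_a(W),W)]$.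
   Context: Background: the training responses are contaminated, $X_i=W_i^\top\beta+B_i+\epsilon_i$, with $B_i$ i.i.d. copies of $B$ independent of the covariates and zero-mean noise $\epsilon_i$, and the first component of the covariates is the constant $1$. The ordinary least squares predictor at $w$ converges in probability, as the sample size $N\to\infty$, to $w^\top\beta+\mathbb E[B]$; the statement takes $N\to\infty$, so $X_a(w)$ denotes this limit. *)

(* Defs.v *)
From HB Require Import structures.
From mathcomp Require Import all_boot all_order all_algebra.
From mathcomp Require Import all_classical all_reals all_analysis.

Set Implicit Arguments.
Unset Strict Implicit.
Unset Printing Implicit Defensive.

Import Order.TTheory GRing.Theory Num.Theory.
Import numFieldNormedType.Exports.

Local Open Scope classical_set_scope.
Local Open Scope ring_scope.

(* Greatest and least element of a set of reals; both are the junk value 0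
   when there is none. [max_ofP] and [min_ofP] show that this does not happen
   for the image of a nonempty closed and bounded subset of R^d. *)
Definition max_of (R : realType) (A : set R) : R := xget 0 (A `&` ubound A).

Definition min_of (R : realType) (A : set R) : R := xget 0 (A `&` lbound A).

(* Vectors of R^d are row vectors, so the product w^T beta of the usual
   column-vector notation reads [w *m beta^T]. *)
Definition dotp (R : realType) (d : nat) (w beta : 'rV[R]_d) : R :=
  (w *m beta^T) 0 0.

Section Model.
Context (R : realType) (d : nat) (beta : 'rV[R]_d).

(* [b] is the mean E[B] of the contamination: the infinite-sample limit of the
   ordinary least squares predictor at [w] is w^T beta + E[B]. *)
Definition alg_pred (b : R) (w : 'rV[R]_d) : R := dotp w beta + b.

Definition clipped_pred (b Xl Xu : R) (w : 'rV[R]_d) : R :=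
  Num.max (Num.min (alg_pred b w) Xu) Xl.

Definition loss (x : R) (w : 'rV[R]_d) : R := (x - dotp w beta) ^+ 2.

End Model.

(* Measurability coordinate by coordinate, which on R^d is the same as Borel
   measurability. *)
Definition random_vector (dO : measure_display) (O : measurableType dO)
    (R : realType) (d : nat) (W : O -> 'rV[R]_d) : Prop :=
  forall i : 'I_d, measurable_fun [set: O] (fun o => W o 0 i).

Section Attained.
Context (R : realType).

Lemma compact_max (A : set R) : A !=set0 -> compact A ->
  (A `&` ubound A) (sup A).
Proof.
move=> A0 cA.
have ubA : has_ubound A.
  have [M [_ /(_ (M + 1))]] := compact_bounded cA.
  rewrite ltrDl ltr01 => /(_ isT) bA.
  by exists (M + 1) => x /bA /=; apply: le_trans; exact: ler_norm.
split; last by move=> x Ax; exact: ub_le_sup.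
have /closure_id clA : closed A.
  by apply: compact_closed => //; exact: Rhausdorff.
by rewrite [X in X _]clA; exact: closure_sup.
Qed.

Lemma dotp_continuous (d : nat) (beta : 'rV[R]_d) :
  continuous (fun w : 'rV[R]_d => dotp w beta).
Proof.
rewrite (_ : (fun _ => _) =
             (fun w : 'rV[R]_d => \sum_i w 0 i * beta 0 i)); last first.
  by apply/funext => w; rewrite /dotp mxE; apply: eq_bigr => i _; rewrite mxE.
apply: continuous_big => [|i _ w]; first exact: add_continuous.
apply: (@continuousM R 'rV[R]_d (fun w => w 0 i) (fun=> beta 0 i)).
  exact: coord_continuous.
exact: cst_continuous.
Qed.

Lemma max_ofP (d : nat) (beta : 'rV[R]_d) (S : set 'rV[R]_d) :
  S !=set0 -> closed S -> bounded_set S ->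
  let A := [set dotp w beta | w in S] in (A `&` ubound A) (max_of A).
Proof.
move=> [w Sw] cS bS A; apply: xgetPex; exists (sup A); apply: compact_max.
  by exists (dotp w beta), w.
apply: continuous_compact; last exact: bounded_closed_compact.
by apply: continuous_subspaceT; exact: dotp_continuous.
Qed.

Lemma min_ofP (d : nat) (beta : 'rV[R]_d) (S : set 'rV[R]_d) :
  S !=set0 -> closed S -> bounded_set S ->
  let A := [set dotp w beta | w in S] in (A `&` lbound A) (min_of A).
Proof.
move=> S0 cS bS A; apply: xgetPex.
have dotN w : dotp w (- beta) = - dotp w beta.
  by rewrite /dotp raddfN /= mulmxN mxE.
have [[w Sw wm] ubm] := max_ofP (- beta) S0 cS bS.
exists (dotp w beta); split; first by exists w.
move=> _ [v Sv <-]; rewrite -lerN2 -!dotN wm; apply: ubm.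
by exists v.
Qed.

End Attained.

(* Main.v *)
(* Write y = w^T beta. The prediction X_a(w) errs by exactly |E[B]|, and the
   hypotheses say X_h^l <= y + |E[B]| and y - |E[B]| <= X_h^u on W. Whenever
   the clipping moves X_a(w), the bound it moves to therefore still lies within
   |E[B]| of y, so the loss cannot increase; integrating the pointwise bound
   gives the inequality between expected losses. *)

Require Import Defs.
From HB Require Import structures.
From mathcomp Require Import all_boot all_order all_algebra.
From mathcomp Require Import all_classical all_reals all_analysis.
From mathcomp Require Import measurable_realfun lra.

Import Order.TTheory GRing.Theory Num.Theory.
Import numFieldNormedType.Exports.

Local Open Scope classical_set_scope.
Local Open Scope ring_scope.

(** A bound that moves [x] lies beyond [x] on one side, so it inherits that half of the estimate
    from [x]; the hypotheses on [u] and [l] supply the other half. *)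
Lemma dist_clip_le (R : realDomainType) (x y l u : R) :
  l <= u -> y - `|x - y| <= u -> l <= y + `|x - y| ->
  `|Num.max (Num.min x u) l - y| <= `|x - y|.
Proof.
(* With both signs of [x - y] bounded by its absolute value, each case is linear in that absolute
   value. *)
move=> lu yu ly; have := ler_norm (x - y); have := lerNnormlW (lexx `|x - y|).
move=> ? ?; rewrite ler_norml maxEle minEle.
by case: (leP x u) => ?; case: (leP _ l) => ?; apply/andP; split; lra.
Qed.

Lemma measurable_dotp (dO : measure_display) (O : measurableType dO)
    (R : realType) (d : nat) (W : O -> 'rV[R]_d) (beta : 'rV[R]_d) :
  random_vector W -> measurable_fun [set: O] (fun o => dotp (W o) beta).
Proof.
move=> mW; rewrite (_ : (fun _ => _) =
  (fun o => \sum_(i <- index_enum 'I_d) W o 0 i * beta 0 i)).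
  by apply: measurable_sum => i; apply: measurable_funM => //; exact: mW.
by apply/funext => o; rewrite /dotp mxE; apply: eq_bigr => i _; rewrite mxE.
Qed.

Lemma measurable_loss (dO : measure_display) (O : measurableType dO)
    (R : realType) (d : nat) (W : O -> 'rV[R]_d) (beta : 'rV[R]_d)
    (X : O -> R) :
  random_vector W -> measurable_fun [set: O] X ->
  measurable_fun [set: O] (fun o => loss beta (X o) (W o)).
Proof.
move=> mW mX; apply: measurable_funX; apply: measurable_funB => //.
exact: measurable_dotp.
Qed.

Theorem theorem3 (R : realType) (d : nat)
    (dO : measure_display) (O : measurableType dO) (P : probability O R)
    (WW : set 'rV[R]_d) (W : O -> 'rV[R]_d) (beta : 'rV[R]_d)
    (B : {RV P >-> R}) (Xl Xu : R) :
  closed WW -> bounded_set WW ->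
  random_vector W -> (forall o, WW (W o)) ->
  P.-integrable [set: O] (fun o => (B o)%:E) ->
  Xl <= Xu ->
  let b := fine ('E_P[B])%E in
  let lin := [set dotp w beta | w in WW] in
  let Xa := alg_pred beta b in
  let Xhat := clipped_pred beta b Xl Xu in
  Xu >= max_of lin - `|b| ->
  Xl <= min_of lin + `|b| ->
  (forall w, WW w -> loss beta (Xhat w) w <= loss beta (Xa w) w) /\
  ('E_P[fun o => loss beta (Xhat (W o)) (W o)]
     <= 'E_P[fun o => loss beta (Xa (W o)) (W o)])%E.
Proof.
move=> cWW bWW mW WWW _ lu b lin Xa Xhat hu hl.
have pointwise w : WW w -> loss beta (Xhat w) w <= loss beta (Xa w) w.
  (* The point [w] itself rules out the default value 0 of [max_of] and [min_of]. *)
  move=> Ww; have WW0 : WW !=set0 by exists w.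
  have [_ /(_ (dotp w beta)) le_max] := max_ofP beta WW0 cWW bWW.
  have [_ /(_ (dotp w beta)) ge_min] := min_ofP beta WW0 cWW bWW.
  have lin_w : lin (dotp w beta) by exists w.
  have err : Xa w - dotp w beta = b by rewrite /Xa /alg_pred addrC addKr.
  (* Squaring is monotone on nonnegative reals, so comparing losses reduces to comparing absolute
     errors. *)
  rewrite /loss -[leLHS]real_normK ?num_real// -[leRHS]real_normK ?num_real//.
  rewrite lerXn2r ?nnegrE//; apply: dist_clip_le => //; rewrite err.
    by apply: le_trans hu; rewrite lerB// le_max.
  by apply: (le_trans hl); rewrite lerD2r ge_min.
have mXa : measurable_fun [set: O] (Xa \o W).
  by apply: measurable_funD => //; exact: measurable_dotp.
(* Both losses are measurable and, being squares, nonnegative, so the integral is monotone; the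
   pointwise bound applies at every [W o]. *)
split=> //; apply: expectation_le.
- apply: measurable_loss => //; apply: measurable_maxr => //.
  exact: measurable_minr.
- exact: measurable_loss.
- by move=> o; exact: sqr_ge0.
- by move=> o; exact: sqr_ge0.
- by apply: aeW => o; exact: pointwise.
Qed.
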